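(* Let $\{x_{k\mid k-1}\}_{k\ge0}$ be generated by the FOA-Min algorithm with $g_k=\nabla_x f(x_k;t_k)$ (described in the context), with step size $\beta=1/L_1$. Suppose that (1) $\|\nabla_{xx}f(x;t)\|\le L_1$ and $\|\nabla_{tx}f(x;t)\|\le L_2$ for all $x\in\mathbb{R}^d$, $t\ge0$; (2) there exists a function $\mathscr{G}:\mathbb{R}\to\mathbb{R}$ such that $f(x;\cdot)-\mathscr{G}(\cdot)$ is twice differentiable for every $x\in\mathbb{R}^d$ and, for all $x\in\mathbb{R}^d$, $t\ge0$: (i) $|\nabla_t[f(x;t)-\mathscr{G}(t)]|\le G_2$; (ii) $|\nabla_{tt}[f(x;t)-\mathscr{G}(t)]|\le L_3$; (iii) $|\nabla_t[f(x;t)-\mathscr{G}(t)]|-Z\|\nabla_x f(x;t)\|\le0$, for some constant $Z\ge0$. Suppose also that $\zeta\ge Z$ and $\delta\le h$, let $\bar G_2:=\frac{\zeta^2L_1}{2}+\zeta L_2+\frac{L_3}{2}+\frac{\zeta\delta}{h}$ and $\epsilon:=\sqrt{2L_1(1+\bar G_2)}\,h$. Suppose that for some $\bar T\in\mathbb{Z}_{\ge0}$ the point $x_{\bar T\mid\bar T-1}$ is an $\epsilon$-stationary point of $f(\cdot;t_{\bar T})$. Then for every $k\ge\bar T$ at least one of the following holds: (a) $x_{k\mid k-1}$ is an $\epsilon$-stationary point of $f(\cdot;t_k)$; (b) there exists an integer $0\le l<k$ such that $x_{l\mid l-1}$ is an $\epsilon$-stationary point of $f(\cdot;t_l)$ and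 $$(f(x_{k\mid k-1};t_k)-f_k^\ast)<(f(x_{l\mid l-1};t_l)-f_l^\ast)+\bar G_2h^2-\frac{1}{2L_1}\|\nabla_x f(x_{l\mid l-1};t_l)\|^2.$$
   Context: $f:\mathbb{R}^d\times\mathbb{R}\to\mathbb{R}$, $(x,t)\mapsto f(x;t)$, is a time-varying objective function; $h>0$ is the sampling period and $t_k:=kh$. For each $t\ge0$ the problem $\min_{x\in\mathbb{R}^d}f(x;t)$ is assumed to have an optimal solution $x^\ast(t)$; $f_k^\ast:=\min_x f(x;t_k)$. A point $x$ is an $\epsilon$-stationary point of $f(\cdot;t)$ if $\|\nabla_x f(x;t)\|\le\epsilon$. Derivatives: $\nabla_x$ is the gradient in $x$, $\nabla_t$ the derivative in $t$, $\nabla_{ba}f:=\nabla_b(\nabla_a f)$ for $a,b\in\{x,t\}$ (so $\nabla_{xx}$ is the Hessian and $\nabla_{tx}f$ is the $t$-derivative of $\nabla_x f$), and these are assumed to exist. $\|\cdot\|$ is the Euclidean/operator norm. $L_1>0$ and $L_2,L_3,G_2\ge0$ are constants. FOA-Min with $g_k=\nabla_x f(x_k;t_k)$ and $C=1$ correction step: given an initial point $x_{0\mid-1}\in\mathbb{R}^d$, step size $\beta$, radius $\zeta>0$ and threshold $\delta>0$, for $k=0,1,2,\dots$: correction: $x_k=x_{k\mid k-1}-\beta\nabla_x f(x_{k\mid k-1};t_k)$; prediction: with $g_k=\nabla_x f(x_k;t_k)$, set $x_{k+1\mid k}=x_k$ if $\|g_k\|\le\delta$, and $x_{k+1\mid k}=x_k-\zeta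 h\,\frac{g_k}{\|g_k\|}$ otherwise. *)

(* Defs.v *)
(* MathComp-Analysis; R^d is 'rV[R]_d over a realType R. *)
From HB Require Import structures.
From mathcomp Require Import all_boot all_order all_algebra.
From mathcomp Require Import all_classical all_reals all_analysis.
Export numFieldNormedType.Exports.
Import Order.TTheory GRing.Theory Num.Theory.

Set Implicit Arguments.
Unset Strict Implicit.
Unset Printing Implicit Defensive.

Local Open Scope classical_set_scope.
Local Open Scope ring_scope.

(* The library norm `|x| on 'rV[R]_d is the max norm, hence this definition.
   Both norms induce the same topology, so differentiability and derivatives
   on 'rV[R]_d are the library's. *)
Definition enorm (R : realType) (d : nat) (v : 'rV[R]_d) : R :=
  Num.sqrt (\sum_(i < d) v ord0 i ^+ 2).

(* Operator norm induced by enorm; as for the library's Jacobian, matrices act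
   on row vectors from the right. *)
Definition opnorm (R : realType) (d : nat) (A : 'M[R]_d) : R :=
  sup [set enorm (v *m A) | v in [set v : 'rV[R]_d | enorm v <= 1]].

Definition grad (R : realType) (d : nat) (g : 'rV[R]_d -> R) (x : 'rV[R]_d) :
    'rV[R]_d :=
  \row_(i < d) 'D_(delta_mx ord0 i) g x.

Definition hessian (R : realType) (d : nat) (g : 'rV[R]_d -> R)
    (x : 'rV[R]_d) : 'M[R]_d :=
  jacobian (grad g) x.

Definition stationary (R : realType) (d : nat) (f : 'rV[R]_d -> R -> R)
    (eps t : R) (x : 'rV[R]_d) : Prop :=
  enorm (grad (f ^~ t) x) <= eps.

Definition minval (R : realType) (d : nat) (f : 'rV[R]_d -> R -> R) (t : R) :
    R :=
  inf (range (f ^~ t)).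

Definition foa_correct (R : realType) (d : nat) (f : 'rV[R]_d -> R -> R)
    (beta t : R) (y : 'rV[R]_d) : 'rV[R]_d :=
  y - beta *: grad (f ^~ t) y.

Definition foa_predict (R : realType) (d : nat) (f : 'rV[R]_d -> R -> R)
    (h zeta delta t : R) (x : 'rV[R]_d) : 'rV[R]_d :=
  let g := grad (f ^~ t) x in
  if enorm g <= delta then x else x - (zeta * h) *: ((enorm g)^-1 *: g).

(* foa_min f h beta zeta delta x0 k is x_{k|k-1}, with x_{0|-1} = x0. *)
Fixpoint foa_min (R : realType) (d : nat) (f : 'rV[R]_d -> R -> R)
    (h beta zeta delta : R) (x0 : 'rV[R]_d) (k : nat) : 'rV[R]_d :=
  match k with
  | 0%N => x0
  | k'.+1 =>
      foa_predict f h zeta delta (k'%:R * h)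
        (foa_correct f beta (k'%:R * h)
          (foa_min f h beta zeta delta x0 k'))
  end.

(* Main.v *)
(* Write F = f - G and m(t) = min F(.; t).  At a minimizer of F(.; t) hypothesis (iii) makes the
   time derivative of F vanish, so m(s) <= m(t) + (L3 / 2) (t - s)^2 for all s, t >= 0, which
   forces m to be constant.  Hence the gap f - f^* changes exactly as F does.

   In a prediction step, move first in time at the fixed point x_k, which costs at most
   Z |g_k| h + (L3 / 2) h^2, and then in space at time t_{k+1}; since grad f(x_k; .) moves by
   at most L2 h, the second move gains zeta h |g_k| up to (zeta L2 + zeta^2 L1 / 2) h^2.
   With the descent |grad f|^2 / (2 L1) of the correction step, the gap grows in one iteration
   by strictly less than G2bar h^2 - |grad f|^2 / (2 L1), which is negative at a
   non-stationary iterate.  So the bound obtained on leaving a stationary iterate l persists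
   until the next stationary one. *)
Require Import Defs.
From HB Require Import structures.
From mathcomp Require Import all_boot all_order all_algebra.
From mathcomp Require Import all_classical all_reals all_analysis.
From mathcomp Require Import ring lra.
Import Order.TTheory GRing.Theory Num.Theory.
Import numFieldNormedType.Exports.

Local Open Scope classical_set_scope.
Local Open Scope ring_scope.

Section euclidean.
Context {R : realType} {d : nat}.
Implicit Types (u v w : 'rV[R]_d) (A : 'M[R]_d).

Definition dot u v : R := \sum_(i < d) u ord0 i * v ord0 i.

Lemma dotC u v : dot u v = dot v u.
Proof. by apply: eq_bigr => i _; rewrite mulrC. Qed.

Lemma dotDl u v w : dot (u + v) w = dot u w + dot v w.
Proof. by rewrite /dot -big_split/=; apply: eq_bigr => i _; rewrite mxE mulrDl. Qed.

Lemma dotZl (a : R) u v : dot (a *: u) v = a * dot u v.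
Proof. by rewrite /dot big_distrr/=; apply: eq_bigr => i _; rewrite mxE mulrA. Qed.

Lemma dotNl u v : dot (- u) v = - dot u v.
Proof. by rewrite -scaleN1r dotZl mulN1r. Qed.

Lemma dotZr (a : R) u v : dot u (a *: v) = a * dot u v.
Proof. by rewrite dotC dotZl dotC. Qed.

Lemma dotNr u v : dot u (- v) = - dot u v.
Proof. by rewrite dotC dotNl dotC. Qed.

Lemma dot_ge0 u : 0 <= dot u u.
Proof. by apply: sumr_ge0 => i _; rewrite -expr2 sqr_ge0. Qed.

Lemma enormE u : enorm u = Num.sqrt (dot u u).
Proof. by congr Num.sqrt; apply: eq_bigr => i _; rewrite expr2. Qed.

Lemma enorm_ge0 u : 0 <= enorm u.
Proof. exact: sqrtr_ge0. Qed.

Lemma sqr_enorm u : enorm u ^+ 2 = dot u u.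
Proof. by rewrite enormE sqr_sqrtr ?dot_ge0. Qed.

Lemma enormZ (a : R) u : enorm (a *: u) = `|a| * enorm u.
Proof. by rewrite !enormE dotZl dotZr mulrA -expr2 sqrtrM ?sqr_ge0// sqrtr_sqr. Qed.

Lemma enormN u : enorm (- u) = enorm u.
Proof. by rewrite -scaleN1r enormZ normrN1 mul1r. Qed.

Lemma enorm_eq0 u : enorm u = 0 -> u = 0.
Proof.
move=> u0; have /eqP : dot u u = 0 by rewrite -sqr_enorm u0 expr0n.
rewrite psumr_eq0 => [/allP uu0|i _]; last by rewrite -expr2 sqr_ge0.
apply/rowP => i; rewrite mxE; apply/eqP; rewrite -sqrf_eq0 expr2.
by apply: uu0; rewrite mem_index_enum.
Qed.

Lemma dot_le u v : `|dot u v| <= enorm u * enorm v.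
Proof.
have [/enorm_eq0 ->|v0] := eqVneq (enorm v) 0.
  by rewrite /dot big1 ?normr0 ?mulr_ge0 ?enorm_ge0// => i _; rewrite mxE mulr0.
rewrite -ler_sqr ?nnegrE ?mulr_ge0 ?enorm_ge0// real_normK ?num_real//.
rewrite exprMn !sqr_enorm.
have b0 : 0 < dot v v by rewrite -sqr_enorm exprn_gt0// lt_neqAle eq_sym v0 enorm_ge0.
have := dot_ge0 (dot v v *: u - dot u v *: v).
have -> : dot (dot v v *: u - dot u v *: v) (dot v v *: u - dot u v *: v) =
    dot v v * (dot u u * dot v v - dot u v ^+ 2).
  rewrite dotDl (dotC _ (_ - _)) (dotC _ (_ - _)) !dotDl !dotNl !dotNr !dotZl !dotZr.
  by rewrite (dotC v u); ring.
by rewrite pmulr_rge0// subr_ge0.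
Qed.

Lemma enorm_mulmx_bounded A : exists C : R, forall v, enorm (v *m A) <= C * enorm v.
Proof.
exists (Num.sqrt (\sum_(j < d) dot (row j A^T) (row j A^T))) => v.
have Cge0 : 0 <= \sum_(j < d) dot (row j A^T) (row j A^T).
  by apply: sumr_ge0 => j _; exact: dot_ge0.
rewrite -ler_sqr ?nnegrE ?mulr_ge0 ?sqrtr_ge0 ?enorm_ge0//.
rewrite exprMn !sqr_enorm sqr_sqrtr// mulr_suml; apply: ler_sum => j _.
have -> : (v *m A) ord0 j = dot v (row j A^T).
  by rewrite mxE; apply: eq_bigr => i _; rewrite !mxE.
rewrite -expr2 -!sqr_enorm -exprMn mulrC -[leLHS]real_normK ?num_real//.
by rewrite ler_sqr ?nnegrE ?mulr_ge0 ?enorm_ge0// dot_le.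
Qed.

Lemma enorm_mulmx_le A v : enorm (v *m A) <= opnorm A * enorm v.
Proof.
have [/enorm_eq0 ->|v0] := eqVneq (enorm v) 0.
  by rewrite mul0mx -(scale0r 0) enormZ normr0 !mul0r mulr0.
have v_gt0 : 0 < enorm v by rewrite lt_neqAle eq_sym v0 enorm_ge0.
rewrite -ler_pdivrMr//; apply: ub_le_sup.
  have [C leC] := enorm_mulmx_bounded A; exists `|C| => _ [w /= w1 <-].
  apply: le_trans (leC w) _; apply: (le_trans (y := `|C| * enorm w)).
    by rewrite ler_wpM2r ?enorm_ge0 ?ler_norm.
  by rewrite -[leRHS]mulr1 ler_wpM2l.
have uv : `|(enorm v)^-1| = (enorm v)^-1 by rewrite ger0_norm ?invr_ge0 ?enorm_ge0.
exists ((enorm v)^-1 *: v) => /=.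
  by rewrite enormZ uv mulVf.
by rewrite -scalemxAl enormZ uv mulrC.
Qed.

End euclidean.

Section derivatives.
Context {R : realType}.

Lemma is_derive_line (V W : normedModType R) (g : V -> W) (x v : V) (s : R) (dg : W) :
  is_derive (x + s *: v) v g dg ->
  is_derive s 1 (fun r : R => g (x + r *: v)) dg.
Proof.
move=> [dgs dgE].
have E : (fun h : R => h^-1 *: (g (x + (h *: (1 : R) + s) *: v) - g (x + s *: v))) =
         (fun h : R => h^-1 *: (g (h *: v + (x + s *: v)) - g (x + s *: v))).
  by apply: funext => h; rewrite scalerDl addrCA [h *: 1]mulr1.
by split; [rewrite /derivable/= E|rewrite -dgE /derive/= E].
Qed.

Lemma is_derive_MVT (p p' : R -> R) :
  (forall s : R, is_derive s 1 p (p' s)) ->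
  forall a b, a < b -> exists2 c, a < c < b & p b - p a = p' c * (b - a).
Proof.
move=> dp a b ab.
have pc : {within `[a, b], continuous p}.
  apply: continuous_subspaceT => s; apply: differentiable_continuous.
  by apply/derivable1_diffP; have [] := dp s.
have [c cab pE] := MVT ab (fun s _ => dp s) pc.
by exists c => //; move: cab; rewrite in_itv.
Qed.

Lemma taylor2_le (p p' p'' : R -> R) (M : R) :
  (forall s : R, is_derive s 1 p (p' s)) ->
  (forall s : R, is_derive s 1 p' (p'' s)) ->
  (forall s : R, 0 <= s <= 1 -> p'' s <= M) ->
  p 1 <= p 0 + p' 0 + M / 2.
Proof.
move=> dp dp' p''M.
pose q (s : R) := p s - p' 0 * s - M / 2 * s ^+ 2.
have dq (s : R) : is_derive s 1 q (p' s - p' 0 - M * s).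
  rewrite /q; apply: is_derive_eq; rewrite /GRing.scale/=; lra.
have [c /andP[c0 c1]] := is_derive_MVT _ _ dq _ _ (@ltr01 R).
have [e /andP[e0 ec]] := is_derive_MVT _ _ dp' _ _ c0.
have := p''M e; rewrite /q; nra.
Qed.

Lemma is_derive_dot (d : nat) (M : R -> 'rV[R]_d) (dM u : 'rV[R]_d) (s : R) :
  is_derive s 1 M dM -> is_derive s 1 (fun r => dot (M r) u) (dot dM u).
Proof.
move=> [dMs dME]; have dMi := (derivable_mxP M s 1).1 dMs.
rewrite (_ : (fun r => _) = \sum_(i < d) (fun r => M r ord0 i * u ord0 i)); last first.
  by apply: funext => r; rewrite fct_sumE.
apply: is_derive_sum => i.
have -> : dM ord0 i * u ord0 i = 'D_1 (fun r => M r ord0 i) s * u ord0 i.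
  by rewrite -dME derive_mx// mxE.
have : is_derive s 1 (fun r => M r ord0 i) ('D_1 (fun r => M r ord0 i) s) by split.
move=> dMis; apply: is_derive_eq; rewrite scaler0 add0r /GRing.scale/= mulrC; lra.
Qed.

End derivatives.

Section gradient.
Context {R : realType} {d : nat}.

Lemma derive_grad (g : 'rV[R]_d -> R) (x v : 'rV[R]_d) :
  differentiable g x -> 'D_v g x = dot (grad g x) v.
Proof.
move=> gx; rewrite deriveE// [in LHS](row_sum_delta v) linear_sum.
by apply: eq_bigr => i _; rewrite linearZ/= mxE deriveE// mulrC.
Qed.

Lemma descent (g : 'rV[R]_d -> R) (L : R) (x v : 'rV[R]_d) :
  (forall y, differentiable g y) ->
  (forall y, differentiable (grad g) y) ->
  (forall y, opnorm (hessian g y) <= L) ->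
  g (x + v) <= g x + dot (grad g x) v + L / 2 * enorm v ^+ 2.
Proof.
move=> dg ddg hL.
have := @taylor2_le R (fun s => g (x + s *: v)) (fun s => dot (grad g (x + s *: v)) v)
  (fun s => dot (v *m hessian g (x + s *: v)) v) (L * enorm v ^+ 2).
rewrite scale1r scale0r addr0 mulrAC; apply => s.
- apply: is_derive_line; rewrite -derive_grad//.
  by split => //; exact: diff_derivable.
- apply: is_derive_dot; apply: (@is_derive_line _ _ _ (grad g)).
  split; first exact: diff_derivable.
  by rewrite deriveEjacobian.
move=> _; apply: le_trans (ler_norm _) _; apply: le_trans (dot_le _ _) _.
rewrite expr2 mulrA ler_wpM2r ?enorm_ge0//.
by apply: le_trans (enorm_mulmx_le _ _) _; rewrite ler_wpM2r ?enorm_ge0.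
Qed.

End gradient.

Lemma taylor2_derive1 (R : realType) (F : R -> R) (M s t : R) :
  (forall r : R, derivable F r 1) -> (forall r : R, derivable (derive1 F) r 1) ->
  (forall r : R, 0 <= r -> `|derive1 (derive1 F) r| <= M) ->
  0 <= s -> 0 <= t ->
  F t <= F s + derive1 F s * (t - s) + M / 2 * (t - s) ^+ 2.
Proof.
move=> dF ddF F''M s0 t0.
have dline (r : R) : is_derive r 1 (fun r : R => s + r * (t - s)) (t - s).
  by apply: is_derive_eq; rewrite /GRing.scale/=; ring.
have dcomp (H : R -> R) : (forall r : R, derivable H r 1) ->
    forall r : R, is_derive r 1 (fun r => H (s + r * (t - s)))
                    (derive1 H (s + r * (t - s)) * (t - s)).
  move=> dH r; apply: (@is_derive1_comp _ H (fun r => s + r * (t - s))).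
  by rewrite derive1E; split.
have := @taylor2_le R (fun r => F (s + r * (t - s)))
  (fun r => derive1 F (s + r * (t - s)) * (t - s))
  (fun r => derive1 (derive1 F) (s + r * (t - s)) * (t - s) ^+ 2) (M * (t - s) ^+ 2).
rewrite mul1r mul0r addr0 subrKC mulrAC; apply.
- exact: dcomp.
- move=> r; have dr := dcomp _ ddF r.
  by apply: is_derive_eq; rewrite scaler0 add0r /GRing.scale/=; ring.
move=> r /andP[r0 r1]; rewrite ler_wpM2r ?sqr_ge0//.
by apply: le_trans (ler_norm _) (F''M _ _); nra.
Qed.

(* Split [s, t] into n equal steps: the error C (t - s)^2 becomes C (t - s)^2 / n. *)
Lemma sqr_bound_le (R : realType) (m : R -> R) (C : R) :
  (forall s t, 0 <= s -> 0 <= t -> m s <= m t + C * (t - s) ^+ 2) ->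
  forall s t, 0 <= s -> 0 <= t -> m s <= m t.
Proof.
move=> mC s t s0 t0; rewrite leNgt; apply/negP => mts.
set D := C * (t - s) ^+ 2.
have [n Dn] : exists n : nat, D / (m s - m t) < n.+1%:R.
  exists (Num.truncn `|D / (m s - m t)|).
  exact: le_lt_trans (ler_norm _) (truncnS_gt _).
have N0 : 0 < n.+1%:R :> R by rewrite ltr0n.
move: n.+1 N0 Dn => N N0.
rewrite ltr_pdivrMr ?subr_gt0// => DN.
have steps k : (k <= N)%N -> m s <= m (s + k%:R * ((t - s) / N%:R)) + k%:R * (D / N%:R ^+ 2).
  elim: k => [_|k IHk kN]; first by rewrite !mul0r !addr0.
  have pt_ge0 (j : nat) : (j <= N)%N -> 0 <= s + j%:R * ((t - s) / N%:R).
    move=> jN; have -> : s + j%:R * ((t - s) / N%:R) = (1 - j%:R / N%:R) * s + j%:R / N%:R * t.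
      by field; rewrite gt_eqF.
    have jN1 : j%:R / N%:R <= 1 :> R by rewrite ler_pdivrMr// mul1r ler_nat.
    by rewrite addr_ge0// mulr_ge0// ?subr_ge0// divr_ge0.
  apply: le_trans (IHk (ltnW kN)) _.
  apply: le_trans (lerD (mC _ _ (pt_ge0 _ (ltnW kN)) (pt_ge0 _ kN)) (lexx _)) _.
  rewrite le_eqVlt; apply/orP; left; apply/eqP.
  by rewrite -natr1 /D; field; rewrite gt_eqF.
have := steps N (leqnn N).
rewrite (_ : s + _ = t); last by field; rewrite gt_eqF.
rewrite (_ : N%:R * _ = D / N%:R); last by field; rewrite gt_eqF.
by rewrite leNgt -ltrBrDl ltr_pdivrMr// mulrC DN.
Qed.

Lemma minvalE (R : realType) (d : nat) (f : 'rV[R]_d -> R -> R) (t : R) (x : 'rV[R]_d) :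
  (forall y, f x t <= f y t) -> minval f t = f x t.
Proof.
move=> xmin; apply/eqP; rewrite eq_le; apply/andP; split.
  by apply: ge_inf; [exists (f x t) => _ [y _ <-]|exists x].
by apply: lb_le_inf; [exists (f x t), x|move=> _ [y _ <-]].
Qed.

Lemma grad_min0 (R : realType) (d : nat) (g : 'rV[R]_d -> R) (x : 'rV[R]_d) :
  (forall y, differentiable g y) -> (forall y, g x <= g y) -> grad g x = 0.
Proof.
move=> dg xmin; apply/rowP => i; rewrite !mxE.
pose v : 'rV[R]_d := delta_mx ord0 i.
have dp (s : R) : is_derive s 1 (fun r : R => g (x + r *: v)) ('D_v g (x + s *: v)).
  by apply: is_derive_line; split => //; exact: diff_derivable.
have cI : (0 : R) \in `](-1), 1[ by rewrite in_itv/=; lra.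
have dp0 (s : R) : s \in `](-1), 1[ -> derivable (fun r : R => g (x + r *: v)) s 1.
  by move=> _; have [] := dp s.
have p0min (s : R) : s \in `](-1), 1[ -> g (x + (0 : R) *: v) <= g (x + s *: v).
  by move=> _; rewrite scale0r addr0.
have [_ d0] := derive1_at_min (ltW (lt_trans (ltrN10 R) (@ltr01 R))) dp0 cI p0min.
have [_] := dp 0; rewrite scale0r addr0 => <-.
exact: d0.
Qed.

Lemma dot_grad_shift (R : realType) (d : nat) (f : 'rV[R]_d -> R -> R) (L t h : R)
    (x u : 'rV[R]_d) :
  (forall s : R, derivable (fun r : R => grad (f ^~ r) x) s 1) ->
  (forall s : R, 0 <= s -> enorm (derive1 (fun r : R => grad (f ^~ r) x) s) <= L) ->
  0 <= t -> 0 < h ->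
  `|dot (grad (f ^~ (t + h)) x) u - dot (grad (f ^~ t) x) u| <= L * enorm u * h.
Proof.
move=> dgf dgfL t0 h0.
have dp (s : R) : is_derive s 1 (fun r => dot (grad (f ^~ r) x) u)
    (dot (derive1 (fun r : R => grad (f ^~ r) x) s) u).
  by apply: is_derive_dot; rewrite derive1E; split.
have tth : t < t + h by rewrite ltrDl.
have [c /andP[tc _] ->] := is_derive_MVT _ _ dp _ _ tth.
rewrite addrAC subrr add0r normrM (gtr0_norm h0) ler_pM2r//.
apply: le_trans (dot_le _ _) _; rewrite ler_wpM2r ?enorm_ge0//.
exact/dgfL/ltW/(le_lt_trans t0).
Qed.

Lemma descent_gradient_step (R : realType) (d : nat) (g : 'rV[R]_d -> R) (L : R)
    (y : 'rV[R]_d) :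
  0 < L ->
  (forall y, differentiable g y) ->
  (forall y, differentiable (grad g) y) ->
  (forall y, opnorm (hessian g y) <= L) ->
  g (y - (1 / L) *: grad g y) <= g y - 1 / (2 * L) * enorm (grad g y) ^+ 2.
Proof.
move=> L0 dg ddg hL.
apply: le_trans (descent g L y _ dg ddg hL) _.
rewrite enormN enormZ dotNr dotZr -sqr_enorm exprMn real_normK ?num_real//.
rewrite le_eqVlt; apply/orP; left; apply/eqP; field.
by rewrite gt_eqF.
Qed.

Lemma foa_predict_lt (R : realType) (d : nat) (f : 'rV[R]_d -> R -> R)
  (G : R -> R) (h L1 L2 L3 Z zeta delta t : R) (x : 'rV[R]_d)
  (h_gt0 : 0 < h) (L1_gt0 : 0 < L1) (L2_ge0 : 0 <= L2)
  (Z_ge0 : 0 <= Z) (zeta_gt0 : 0 < zeta) (delta_gt0 : 0 < delta)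
  (f_dx : forall (x : 'rV[R]_d) (t : R), differentiable (f ^~ t) x)
  (f_dxx : forall (x : 'rV[R]_d) (t : R), differentiable (grad (f ^~ t)) x)
  (f_dtx : forall (x : 'rV[R]_d) (t : R),
     derivable (fun s : R => grad (f ^~ s) x) t 1)
  (f_xx_le : forall (x : 'rV[R]_d) (t : R), 0 <= t ->
     opnorm (hessian (f ^~ t) x) <= L1)
  (f_tx_le : forall (x : 'rV[R]_d) (t : R), 0 <= t ->
     enorm (derive1 (fun s : R => grad (f ^~ s) x) t) <= L2)
  (fG_dt : forall (x : 'rV[R]_d) (t : R),
     derivable (fun s : R => f x s - G s) t 1)
  (fG_dtt : forall (x : 'rV[R]_d) (t : R),
     derivable (derive1 (fun s : R => f x s - G s)) t 1)
  (fG_tt_le : forall (x : 'rV[R]_d) (t : R), 0 <= t ->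
     `|derive1 (derive1 (fun s : R => f x s - G s)) t| <= L3)
  (fG_t_grad : forall (x : 'rV[R]_d) (t : R), 0 <= t ->
     `|derive1 (fun s : R => f x s - G s) t| - Z * enorm (grad (f ^~ t) x) <= 0)
  (Z_le_zeta : Z <= zeta) (t_ge0 : 0 <= t) :
  f (foa_predict f h zeta delta t x) (t + h) - G (t + h) <
  f x t - G t + (zeta ^+ 2 * L1 / 2 + zeta * L2 + L3 / 2 + zeta * delta / h) * h ^+ 2.
Proof.
have th_ge0 : 0 <= t + h by rewrite addr_ge0// ltW.
set g := grad (f ^~ t) x.
have Ft : f x (t + h) - G (t + h) <= f x t - G t + Z * enorm g * h + L3 / 2 * h ^+ 2.
  apply: le_trans (taylor2_derive1 _ _ _ _ _ (fG_dt x) (fG_dtt x) (fG_tt_le x)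
    t_ge0 th_ge0) _.
  rewrite (addrC t) addrK lerD2r lerD2l ler_pM2r//.
  by apply: le_trans (ler_norm _) _; rewrite -subr_le0; exact: fG_t_grad.
have -> : (zeta ^+ 2 * L1 / 2 + zeta * L2 + L3 / 2 + zeta * delta / h) * h ^+ 2 =
    zeta ^+ 2 * L1 / 2 * h ^+ 2 + zeta * L2 * h ^+ 2 + L3 / 2 * h ^+ 2
      + zeta * delta * h.
  by field; rewrite gt_eqF.
have e1 : 0 < zeta ^+ 2 * L1 / 2 * h ^+ 2 by rewrite !mulr_gt0 ?exprn_gt0// invr_gt0.
have e2 : 0 <= zeta * L2 * h ^+ 2 by rewrite !mulr_ge0 ?sqr_ge0// ltW.
have e3 : 0 < zeta * delta * h by rewrite !mulr_gt0.
rewrite /foa_predict -/g; case: ifPn => [gd|]; last rewrite -ltNge => dg.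
  have : Z * enorm g * h <= zeta * delta * h.
    by rewrite ler_pM2r// ler_pM ?enorm_ge0.
  lra.
have g_gt0 : 0 < enorm g by exact: lt_trans dg.
set u := (enorm g)^-1 *: g.
have u1 : enorm u = 1.
  by rewrite enormZ gtr0_norm ?invr_gt0// mulVf// gt_eqF.
have gu : dot g u = enorm g.
  by rewrite dotZr -sqr_enorm expr2 mulKf// gt_eqF.
have := descent (f ^~ (t + h)) L1 x (- ((zeta * h) *: u)) (f_dx ^~ _) (f_dxx ^~ _)
  (fun y => f_xx_le y _ th_ge0).
rewrite dotNr dotZr enormN enormZ u1 mulr1 real_normK ?num_real//.
have := dot_grad_shift _ _ f L2 t h x u (f_dtx x) (f_tx_le x) t_ge0 h_gt0.
rewrite -/g gu u1 mulr1 ler_norml => /andP[shift _] desc.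
have zh : 0 < zeta * h by rewrite mulr_gt0.
have : zeta * h * (enorm g - L2 * h) <= zeta * h * dot (grad (f ^~ (t + h)) x) u.
  by rewrite ler_pM2l//; lra.
have : Z * enorm g * h <= zeta * enorm g * h by rewrite !ler_pM2r.
nra.
Qed.

Theorem theorem5 (R : realType) (d : nat) (f : 'rV[R]_d -> R -> R)
  (G : R -> R) (h L1 L2 L3 G2 Z zeta delta : R) (x0 : 'rV[R]_d) (Tbar : nat)
  (h_gt0 : 0 < h) (L1_gt0 : 0 < L1) (L2_ge0 : 0 <= L2) (L3_ge0 : 0 <= L3)
  (G2_ge0 : 0 <= G2) (Z_ge0 : 0 <= Z) (zeta_gt0 : 0 < zeta)
  (delta_gt0 : 0 < delta)
  (f_min : forall t : R, 0 <= t ->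
     exists xstar : 'rV[R]_d, forall y : 'rV[R]_d, f xstar t <= f y t)
  (f_dx : forall (x : 'rV[R]_d) (t : R), differentiable (f ^~ t) x)
  (f_dxx : forall (x : 'rV[R]_d) (t : R), differentiable (grad (f ^~ t)) x)
  (f_dtx : forall (x : 'rV[R]_d) (t : R),
     derivable (fun s : R => grad (f ^~ s) x) t 1)
  (f_xx_le : forall (x : 'rV[R]_d) (t : R), 0 <= t ->
     opnorm (hessian (f ^~ t) x) <= L1)
  (f_tx_le : forall (x : 'rV[R]_d) (t : R), 0 <= t ->
     enorm (derive1 (fun s : R => grad (f ^~ s) x) t) <= L2)
  (fG_dt : forall (x : 'rV[R]_d) (t : R),
     derivable (fun s : R => f x s - G s) t 1)
  (fG_dtt : forall (x : 'rV[R]_d) (t : R),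
     derivable (derive1 (fun s : R => f x s - G s)) t 1)
  (fG_t_le : forall (x : 'rV[R]_d) (t : R), 0 <= t ->
     `|derive1 (fun s : R => f x s - G s) t| <= G2)
  (fG_tt_le : forall (x : 'rV[R]_d) (t : R), 0 <= t ->
     `|derive1 (derive1 (fun s : R => f x s - G s)) t| <= L3)
  (fG_t_grad : forall (x : 'rV[R]_d) (t : R), 0 <= t ->
     `|derive1 (fun s : R => f x s - G s) t| - Z * enorm (grad (f ^~ t) x) <= 0)
  (Z_le_zeta : Z <= zeta) (delta_le_h : delta <= h) :
  let G2bar := zeta ^+ 2 * L1 / 2 + zeta * L2 + L3 / 2 + zeta * delta / h in
  let eps := Num.sqrt (2 * L1 * (1 + G2bar)) * h in
  let x := foa_min f h (1 / L1) zeta delta x0 in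
  stationary f eps (Tbar%:R * h) (x Tbar) ->
  forall k : nat, (Tbar <= k)%N ->
    stationary f eps (k%:R * h) (x k)
    \/ exists l : nat,
         [/\ (l < k)%N,
             stationary f eps (l%:R * h) (x l)
           & f (x k) (k%:R * h) - minval f (k%:R * h)
             < f (x l) (l%:R * h) - minval f (l%:R * h) + G2bar * h ^+ 2
               - 1 / (2 * L1) * enorm (grad (f ^~ (l%:R * h)) (x l)) ^+ 2].
Proof.
move=> G2bar eps x xT.
have tk (k : nat) : 0 <= k%:R * h by rewrite mulr_ge0// ltW.
have minG : forall s t, 0 <= s -> 0 <= t -> minval f s - G s <= minval f t - G t.
  apply: (sqr_bound_le _ _ (L3 / 2)) => s t s0 t0.
  have [xs xs_min] := f_min _ s0; have [xt xt_min] := f_min _ t0.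
  rewrite (minvalE _ _ _ _ _ xs_min) (minvalE _ _ _ _ _ xt_min).
  apply: le_trans (lerB (xs_min xt) (lexx _)) _.
  apply: le_trans (taylor2_derive1 _ _ _ _ _ (fG_dt xt) (fG_dtt xt) (fG_tt_le xt) t0 s0) _.
  have : `|derive1 (fun s : R => f xt s - G s) t| <= 0.
    have := fG_t_grad xt t t0.
    rewrite (grad_min0 _ _ _ _ (f_dx ^~ t) xt_min).
    by rewrite -[X in enorm X](scale0r (0 : 'rV[R]_d)) enormZ normr0 mul0r mulr0 subr0.
  by rewrite normr_le0 => /eqP ->; rewrite mul0r addr0 -[(s - t) ^+ 2]sqrrN opprB.
have step k : f (x k.+1) (k.+1%:R * h) - minval f (k.+1%:R * h) <
    f (x k) (k%:R * h) - minval f (k%:R * h) + G2bar * h ^+ 2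
      - 1 / (2 * L1) * enorm (grad (f ^~ (k%:R * h)) (x k)) ^+ 2.
  have kS : k.+1%:R * h = k%:R * h + h by rewrite -natr1 mulrDl mul1r.
  have := minG _ _ (tk k) (tk k.+1).
  have := descent_gradient_step _ _ (f ^~ (k%:R * h)) L1 (x k) L1_gt0
    (f_dx ^~ _) (f_dxx ^~ _) (fun y => f_xx_le y _ (tk k)).
  have := foa_predict_lt _ _ f G h L1 L2 L3 Z zeta delta (k%:R * h)
    (foa_correct f (1 / L1) (k%:R * h) (x k)) h_gt0 L1_gt0 L2_ge0 Z_ge0
    zeta_gt0 delta_gt0 f_dx f_dxx f_dtx f_xx_le f_tx_le fG_dt fG_dtt fG_tt_le
    fG_t_grad Z_le_zeta (tk k).
  rewrite -kS -/G2bar; rewrite [x k.+1]/=/foa_correct -/(x k).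
  lra.
have G2bar_ge0 : 0 <= G2bar.
  by rewrite !addr_ge0// ?divr_ge0// ?mulr_ge0 ?sqr_ge0// ltW.
elim=> [|k IHk] Tk.
  by left; move: xT; rewrite (_ : Tbar = 0%N)//; apply/eqP; rewrite -leqn0.
have [kst|kNst] := pselect (stationary f eps (k.+1%:R * h) (x k.+1)); first by left.
right; have {}Tk : (Tbar <= k)%N.
  move: Tk; rewrite leq_eqVlt => /orP[/eqP TkS|//].
  by move: xT; rewrite TkS.
have [kst'|kNst'] := pselect (stationary f eps (k%:R * h) (x k)).
  by exists k; split.
have [//|[l [lk lst le]]] := IHk Tk.
exists l; split => //; first exact: ltnW.
apply: lt_trans le; apply: lt_le_trans (step k) _.
rewrite -[leRHS]addr0 -addrA lerD2l subr_le0.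
move/negP: kNst'; rewrite /stationary -ltNge.
set N := enorm _ => epsN.
have eps2 : eps ^+ 2 = 2 * L1 * (1 + G2bar) * h ^+ 2.
  by rewrite exprMn sqr_sqrtr//; nra.
have eps_ge0 : 0 <= eps by rewrite mulr_ge0 ?sqrtr_ge0// ltW.
rewrite mul1r ler_pdivlMl ?mulr_gt0//.
apply: (le_trans (y := eps ^+ 2)); last by rewrite ler_sqr ?nnegrE ?enorm_ge0// ltW.
rewrite eps2 mulrA ler_pM2r ?exprn_gt0// ler_pM2l ?mulr_gt0//.
by rewrite lerDr.
Qed.
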